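(* Let $L/K$ be a finite Galois extension of fields with Galois group $G$, let $N$ be a $G$-stable regular subgroup of $\mathrm{Perm}(G)$, let $g\in G$ and $N_g=\rho(g)N\rho(g)^{-1}$. Then an intermediate field $M$ of $L/K$ is realizable with respect to $L[N]^G$ if and only if the intermediate field $g(M)$ is realizable with respect to $L[N_g]^G$.
   Context: $\mathrm{Perm}(G)$ is the group of permutations of the set $G$; $\lambda(g)[h]=gh$, $\rho(g)[h]=hg^{-1}$. A subgroup $N\le\mathrm{Perm}(G)$ is regular if it acts simply transitively on $G$, and $G$-stable if normalized by $\lambda(G)$; then $N_g$ is also $G$-stable regular. $G$ acts on $L[N]$ by $g\ast\sum_\eta c_\eta\eta=\sum_\eta g(c_\eta)\lambda(g)\eta\lambda(g)^{-1}$, and the fixed ring $L[N]^G$ is a cocommutative $K$-Hopf algebra (with the Hopf structure inherited from the group algebra $L[N]$, counit $\varepsilon(\sum c_\eta\eta)=\sum c_\eta$) acting on $L$ by $\left(\sum_\eta c_\eta\eta\right)\cdot x=\sum_\eta c_\eta\,\eta^{-1}[e_G](x)$; this gives a Hopf-Galois structure on $L/K$. For a Hopf subalgebra $H'$ of such a Hopf algebra $H$, its fixed field is $L^{H'}=\{x\in L : z\cdot x=\varepsilon(z)x \text{ for all } z\in H'\}$. An intermediate field $M$ is realizable with respect to $H$ if $M=L^{H'}$ for some Hopf subalgebra $H'$ of $H$. *)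

(* Defs.v *)
From HB Require Import structures.
From mathcomp Require Import all_boot all_order all_algebra.
From mathcomp Require Import all_fingroup all_solvable all_field.

Set Implicit Arguments.
Unset Strict Implicit.
Unset Printing Implicit Defensive.

Import GRing.Theory.
Local Open Scope ring_scope.

(* In MathComp the products of {perm T} and of gal_of E are in diagrammatic
   order: x * y is "first x, then y".  Below, permutations and Galois
   automorphisms are composed as functions, as shown by permcE and galcE. *)

Definition permc (T : finType) (s t : {perm T}) : {perm T} := (t * s)%g.

Lemma permcE (T : finType) (s t : {perm T}) x : permc s t x = s (t x).
Proof. exact: permM. Qed.

(* So the conjugate s t s^-1 of the usual convention is t ^ s, and
   s N s^-1 is N :^ s. *)
Lemma permcJ (T : finType) (s t : {perm T}) :
  permc s (permc t s^-1%g) = (t ^ s)%g.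
Proof. by rewrite /permc conjgE mulgA. Qed.

(* Gal(L/K) for L over its base field K, as a group type: every element of
   gal_of {:L} is a K-automorphism of L and conversely. *)
Notation galG L := (gal_of {:L}%VS).

Section HopfGalois.

Variables (K : fieldType) (L : splittingFieldType K).

Local Notation G := (galG L).

Definition galc (g h : G) : G := (h * g)%g.

Lemma galcE (g h : G) (x : L) : galc g h x = g (h x).
Proof. by rewrite galM ?memvf. Qed.

Fact lambda_inj (g : G) : injective (fun h : G => galc g h).
Proof. exact: mulIg. Qed.

Definition lambda (g : G) : {perm G} := perm (@lambda_inj g).

Fact rho_inj (g : G) : injective (fun h : G => galc h g^-1%g).
Proof. exact: mulgI. Qed.

Definition rho (g : G) : {perm G} := perm (@rho_inj g).

Definition regular (N : {set {perm G}}) : Prop :=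
  forall x y : G, exists! eta : {perm G}, eta \in N /\ eta x = y.

Definition Gstable (N : {set {perm G}}) : Prop :=
  [set lambda g | g : G] \subset 'N(N)%g.

(* An element \sum_eta c_eta eta of the group algebra L[Perm(G)] is the finite
   function eta |-> c_eta; it is a K-vector space for the pointwise structure.
   The pointwise product of finite functions is NOT the product of the group
   algebra, which is galg_mul below. *)
Definition galg := {ffun {perm G} -> L}.

(* L[N] (x)_L L[N] is L[N x N], inside L[Perm(G) x Perm(G)]. *)
Definition galg2 := {ffun {perm G} * {perm G} -> L}.

(* The one-term formal sum c i *)
Definition term (I : finType) (c : L) (i : I) : {ffun I -> L} :=
  [ffun j => if j == i then c else 0].

Definition galg_one : galg := term 1 1%g.

Definition galg_mul (a b : galg) : galg :=
  \sum_(eta : {perm G}) \sum_(mu : {perm G})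
    term (a eta * b mu) (permc eta mu).

Definition galg_antipode (z : galg) : galg :=
  \sum_(eta : {perm G}) term (z eta) eta^-1%g.

Definition galg_counit (z : galg) : L := \sum_(eta : {perm G}) z eta.

Definition galg_comul (z : galg) : galg2 :=
  \sum_(eta : {perm G}) term (z eta) (eta, eta).

Definition galg_tens (a b : galg) : galg2 :=
  [ffun p => a p.1 * b p.2].

Definition gal_star (g : G) (z : galg) : galg :=
  \sum_(eta : {perm G}) term (g (z eta)) (eta ^ lambda g)%g.

Definition in_LN (N : {set {perm G}}) (z : galg) : Prop :=
  forall eta, eta \notin N -> z eta = 0.

Definition in_LNG (N : {set {perm G}}) (z : galg) : Prop :=
  in_LN N z /\ forall g : G, gal_star g z = z.

Definition hopf_act (z : galg) (x : L) : L :=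
  \sum_(eta : {perm G}) z eta * ((eta^-1)%g (1%g : G)) x.

(* For U a K-subspace of H = L[N]^G, U (x)_K U is identified with its image in
   L[N] (x)_L L[N]: the canonical map H (x)_K H -> L[N] (x)_L L[N] is injective
   because L (x)_K H = L[N] by Galois descent, and the comultiplication of H is
   the restriction of that of L[N] through this identification. *)
Definition in_tensor_square (U : {vspace galg}) (t : galg2) : Prop :=
  exists (n : nat) (a b : 'I_n -> galg),
    (forall i, a i \in U /\ b i \in U) /\ t = \sum_(i < n) galg_tens (a i) (b i).

Record hopf_subalgebra (N : {set {perm G}}) (H' : {vspace galg}) : Prop :=
  HopfSubalgebra {
    hopf_sub : forall z, z \in H' -> in_LNG N z;
    hopf_one : galg_one \in H';
    hopf_mul : forall a b, a \in H' -> b \in H' -> galg_mul a b \in H';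
    hopf_comul : forall z, z \in H' -> in_tensor_square H' (galg_comul z);
    hopf_antipode : forall z, z \in H' -> galg_antipode z \in H'
  }.

Definition in_fixed_field (H' : {vspace galg}) (x : L) : Prop :=
  forall z, z \in H' -> hopf_act z x = galg_counit z * x.

Definition realizable (N : {set {perm G}}) (M : {subfield L}) : Prop :=
  exists H' : {vspace galg},
    hopf_subalgebra N H' /\ forall x : L, x \in M <-> in_fixed_field H' x.

End HopfGalois.

(* Main.v *)
Require Import Defs.
From HB Require Import structures.
From mathcomp Require Import all_boot all_order all_algebra.
From mathcomp Require Import all_fingroup all_solvable all_field.

Set Implicit Arguments.
Unset Strict Implicit.
Unset Printing Implicit Defensive.

Import GRing.Theory.
Local Open Scope ring_scope.

(** Conjugation by rho(g) is an automorphism of the Hopf algebra L[Perm(G)]; it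
    commutes with the G-action because rho(g) commutes with lambda(G), so it maps
    L[N]^G isomorphically onto L[N_g]^G and carries Hopf subalgebras to Hopf
    subalgebras.  If phi denotes this map and z is G-fixed, substituting
    eta = lambda(g) mu lambda(g)^-1 in the sum defining phi(z) . g(x) gives
    phi(z) . g(x) = g(z . x), whereas the counit of z is G-fixed and preserved by
    phi.  Hence the fixed field of phi(H') is g applied to that of H'.  The
    converse is the same statement for g^-1. *)

Section Pullback.

Variables (K : fieldType) (L : splittingFieldType K).

(** Formal sums are coefficient functions, so reindexing them is precomposition. General index types
    let one proof of K-linearity serve both the group algebra and its tensor square. *)
Definition pullback (I J : finType) (h : I -> J) (z : {ffun J -> L}) :
  {ffun I -> L} := [ffun i => z (h i)].

Fact pullback_is_linear (I J : finType) (h : I -> J) :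
  linear (@pullback I J h : {ffun J -> L} -> {ffun I -> L}).
Proof. by move=> a u v; apply/ffunP => i; rewrite !ffunE. Qed.

HB.instance Definition _ (I J : finType) (h : I -> J) :=
  GRing.isLinear.Build K {ffun J -> L} {ffun I -> L} _ (@pullback I J h)
    (@pullback_is_linear I J h).

Lemma pullback_term (I J : finType) (h : I -> J) (k : J -> I) c i :
  cancel h k -> cancel k h -> pullback h (term c i) = term c (k i) :> {ffun I -> L}.
Proof.
by move=> hk kh; apply/ffunP => j; rewrite !ffunE -(can2_eq hk kh).
Qed.

End Pullback.

Section Twist.

Variables (K : fieldType) (L : splittingFieldType K).
Local Notation G := (galG L).
Implicit Types (s : {perm G}) (z a b : galg L) (N : {set {perm G}}).

Lemma lambdaE (g h : G) : lambda g h = (h * g)%g.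
Proof. by rewrite permE. Qed.

Lemma rhoE (g h : G) : rho g h = (g^-1 * h)%g.
Proof. by rewrite permE. Qed.

Lemma lambdaV (g : G) : lambda g^-1%g = (lambda g)^-1%g.
Proof.
apply/esym/eqP; rewrite eq_invg_mul; apply/eqP/permP => h.
by rewrite permM !lambdaE perm1 mulgK.
Qed.

Lemma rhoV (g : G) : rho g^-1%g = (rho g)^-1%g.
Proof.
apply/esym/eqP; rewrite eq_invg_mul; apply/eqP/permP => h.
by rewrite permM !rhoE perm1 invgK mulKVg.
Qed.

Lemma lambda_rho_commute (g h : G) : commute (lambda g) (rho h).
Proof. by apply/permP => x; rewrite !permM !(lambdaE, rhoE) mulgA. Qed.

(** Linear extension of conjugation by [s]: sending each [eta] to [eta ^ s] moves coefficients, so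
    the new one at [eta] is read off at [eta ^ s^-1]. *)
Definition twist s : galg L -> galg L :=
  pullback (fun eta : {perm G} => eta ^ s^-1)%g.

(** This is the tensor square of [twist s], needed to transport comultiplications. *)
Definition twist2 s : galg2 L -> galg2 L :=
  pullback (fun p : {perm G} * {perm G} => (p.1 ^ s^-1, p.2 ^ s^-1))%g.

Lemma twistE s z eta : twist s z (eta ^ s)%g = z eta.
Proof. by rewrite ffunE conjgK. Qed.

Lemma twist_sum s (I : finType) (F : I -> galg L) :
  twist s (\sum_i F i) = \sum_i twist s (F i).
Proof. exact: linear_sum. Qed.

Lemma twist2_sum s (I : finType) (F : I -> galg2 L) :
  twist2 s (\sum_i F i) = \sum_i twist2 s (F i).
Proof. exact: linear_sum. Qed.

Lemma twist_term s c eta : twist s (term c eta) = term c (eta ^ s)%g.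
Proof. exact: pullback_term (conjgKV s) (conjgK s). Qed.

Lemma twist2_term s c eta mu :
  twist2 s (term c (eta, mu)) = term c (eta ^ s, mu ^ s)%g.
Proof.
apply: (@pullback_term _ _ _ _ _ (fun p : _ * _ => (p.1 ^ s, p.2 ^ s))%g) => -[? ?].
  by rewrite /= !conjgKV.
by rewrite /= !conjgK.
Qed.

Lemma twist_one s : twist s (galg_one L) = galg_one L.
Proof. by rewrite /galg_one twist_term conj1g. Qed.

Lemma twist_mul s a b :
  twist s (galg_mul a b) = galg_mul (twist s a) (twist s b).
Proof.
rewrite /galg_mul twist_sum [RHS](reindex_inj (conjg_inj s)).
apply: eq_bigr => eta _; rewrite twist_sum [RHS](reindex_inj (conjg_inj s)).
by apply: eq_bigr => mu _; rewrite twist_term !twistE /permc conjMg.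
Qed.

Lemma twist_antipode s z :
  twist s (galg_antipode z) = galg_antipode (twist s z).
Proof.
rewrite /galg_antipode twist_sum [RHS](reindex_inj (conjg_inj s)).
by apply: eq_bigr => eta _; rewrite twist_term twistE conjVg.
Qed.

Lemma twist_counit s z : galg_counit (twist s z) = galg_counit z.
Proof.
rewrite /galg_counit (reindex_inj (conjg_inj s)).
by apply: eq_bigr => eta _; rewrite twistE.
Qed.

Lemma twist2_comul s z : twist2 s (galg_comul z) = galg_comul (twist s z).
Proof.
rewrite /galg_comul twist2_sum [RHS](reindex_inj (conjg_inj s)).
by apply: eq_bigr => eta _; rewrite twist2_term twistE.
Qed.

Lemma twist2_tens s a b :
  twist2 s (galg_tens a b) = galg_tens (twist s a) (twist s b).
Proof. by apply/ffunP => p; rewrite !ffunE. Qed.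

Lemma twist_star (g h : G) z :
  twist (rho g) (gal_star h z) = gal_star h (twist (rho g) z).
Proof.
rewrite /gal_star twist_sum [RHS](reindex_inj (conjg_inj (rho g))).
(* Both sides conjugate [eta] by [lambda h] and [rho g], in opposite orders. *)
apply: eq_bigr => eta _; rewrite twist_term twistE -!conjgM.
by rewrite lambda_rho_commute.
Qed.

Lemma in_LNG_twist N (g : G) z :
  in_LNG N z -> in_LNG (N :^ rho g)%g (twist (rho g) z).
Proof.
case=> zN zG; split=> [eta|h]; last by rewrite -twist_star zG.
by rewrite mem_conjg ffunE => /zN.
Qed.

Lemma gal_starE (g : G) z eta : gal_star g z (eta ^ lambda g)%g = g (z eta).
Proof.
rewrite sum_ffunE (bigD1 eta) //= ffunE eqxx big1 ?addr0 // => mu neq.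
by rewrite ffunE (inj_eq (conjg_inj _)) eq_sym (negPf neq).
Qed.

Lemma counit_star (g : G) z : galg_counit (gal_star g z) = g (galg_counit z).
Proof.
rewrite /galg_counit (reindex_inj (conjg_inj (lambda g))) rmorph_sum.
by apply: eq_bigr => eta _; rewrite gal_starE.
Qed.

Lemma hopf_act_twist (g : G) z x :
  hopf_act (twist (rho g) (gal_star g z)) (g x) = g (hopf_act z x).
Proof.
rewrite /hopf_act (reindex_inj (conjg_inj (rho g))) /=.
rewrite (reindex_inj (conjg_inj (lambda g))) rmorph_sum.
apply: eq_bigr => eta _; rewrite twistE gal_starE rmorphM /=; congr (_ * _).
(* The composite of [lambda g] and [rho g] is the inner automorphism of G given by g. It fixes the
   identity, so if [eta^-1] sends the identity to h, its conjugate sends it to g h g^-1, which maps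
   g(x) to g(h(x)). *)
rewrite -!conjVg -conjgM conjgE !permM invMg !permM -lambdaV -rhoV.
rewrite !(lambdaE, rhoE) invgK mulg1 mulgV.
by rewrite -!galM ?memvf // mulKVg.
Qed.

Lemma in_fixed_field_twist N (g : G) (H' : {vspace galg L}) x :
    (forall z, z \in H' -> in_LNG N z) ->
  in_fixed_field (linfun (twist (rho g)) @: H')%VS (g x) <-> in_fixed_field H' x.
Proof.
move=> sH.
(* Since z is G-fixed, [gal_star g z] is z itself: both sides of the fixed-field equation for the
   twisted z at g(x) are the images under g of those for z at x. Injectivity of g then allows going
   back. *)
have twz z : z \in H' ->
    (hopf_act (twist (rho g) z) (g x) = g (hopf_act z x)) *
    (galg_counit (twist (rho g) z) * g x = g (galg_counit z * x)).
  move=> /sH[_ /(_ g) zg]; rewrite -hopf_act_twist rmorphM /= -counit_star zg.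
  by rewrite twist_counit.
split=> fx z Hz.
  have := fx _ (memv_img (linfun (twist (rho g))) Hz).
  by rewrite lfunE /= !twz // => /fmorph_inj.
by case/memv_imgP: Hz => y Hy ->; rewrite lfunE /= !twz // fx.
Qed.

Lemma hopf_subalgebra_twist N (g : G) (H' : {vspace galg L}) :
  hopf_subalgebra N H' ->
  hopf_subalgebra (N :^ rho g)%g (linfun (twist (rho g)) @: H')%VS.
Proof.
case=> sH oneH mulH comulH antiH.
have tw z : z \in H' -> twist (rho g) z \in (linfun (twist (rho g)) @: H')%VS.
  by move=> Hz; have := memv_img (linfun (twist (rho g))) Hz; rewrite lfunE.
split.
- by move=> _ /memv_imgP[z Hz ->]; rewrite lfunE; apply/in_LNG_twist/sH.
- by rewrite -(twist_one (rho g)) tw.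
- move=> _ _ /memv_imgP[a Ha ->] /memv_imgP[b Hb ->]; rewrite !lfunE /=.
  by rewrite -twist_mul tw ?mulH.
- move=> _ /memv_imgP[z Hz ->]; rewrite lfunE /=.
  have [n [a [b [Hab def_z]]]] := comulH z Hz.
  (* Twist both tensor factors of a decomposition of [galg_comul z]. *)
  exists n, (fun i => twist (rho g) (a i)), (fun i => twist (rho g) (b i)).
  split=> [i|]; first by have [? ?] := Hab i; rewrite !tw.
  rewrite -twist2_comul def_z twist2_sum.
  by apply: eq_bigr => i _; rewrite twist2_tens.
- move=> _ /memv_imgP[z Hz ->]; rewrite lfunE /=.
  by rewrite -twist_antipode tw ?antiH.
Qed.

Lemma gal_img_mem (g : G) (M : {subfield L}) x :
  (x \in (g @: M)%AS) = (g^-1%g x \in M).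
Proof.
have gK y : g (g^-1%g y) = y by rewrite -galM ?memvf // mulVg gal_id.
have gVK y : g^-1%g (g y) = y by rewrite -galM ?memvf // mulgV gal_id.
apply/idP/idP => [/memv_imgP[y My ->]|Mx]; first by rewrite gVK.
by rewrite -[x]gK memv_img.
Qed.

Lemma realizable_twist N (g : G) (M : {subfield L}) :
  realizable N M -> realizable (N :^ rho g)%g (g @: M)%AS.
Proof.
case=> H' [hH fixH]; exists (linfun (twist (rho g)) @: H')%VS.
split=> [|x]; first exact: hopf_subalgebra_twist.
have {2}-> : x = g (g^-1%g x) by rewrite -galM ?memvf // mulVg gal_id.
rewrite gal_img_mem; apply: iff_trans (fixH _) _; apply: iff_sym.
exact: in_fixed_field_twist (hopf_sub hH).
Qed.

End Twist.

Theorem theorem3p2 (K : fieldType) (L : splittingFieldType K)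
    (N : {group {perm galG L}}) (g : galG L) (M : {subfield L}) :
  galois 1%VS {:L}%VS -> regular N -> Gstable N ->
  (realizable N M <-> realizable (N :^ rho g)%g (g @: M)%AS).
Proof.
move=> _ _ _; split=> [|/(realizable_twist g^-1%g)]; first exact: realizable_twist.
(* Conjugating back returns exactly N, but the field obtained is g^-1(g(M)); the same [H'] works
   because this field has the same elements as M. *)
rewrite rhoV conjsgK => -[H' [hH fixH]]; exists H'; split=> // x.
apply: iff_trans (fixH x).
by rewrite !gal_img_mem -galM ?memvf // invgK mulgV gal_id.
Qed.
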